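(* Let $n,m\ge 1$ be integers, let $A_0,A_1,\ldots,A_m\in\mathbb{R}^{n\times n}$ and let $\tau_1,\ldots,\tau_m>0$. Let $X(t)\in\mathbb{R}^{n\times n}$ be the fundamental matrix of the linear delay differential system $$\dot{x}(t)=A_0x(t)+\sum_{j=1}^{m}A_jx(t-\tau_j).$$ Then this system is asymptotically stable if and only if $$\int_0^\infty\|X(\sigma)\|_F^{2}\,d\sigma\quad\text{exists and is finite},$$ where $\|\cdot\|_F$ denotes the Frobenius norm.
   Context: The fundamental matrix $X:\mathbb{R}\to\mathbb{R}^{n\times n}$ of the system $\dot{x}(t)=A_0x(t)+\sum_{j=1}^{m}A_jx(t-\tau_j)$ is the unique function that is continuous on $[0,\infty)$ and satisfies $$\dot{X}(t)=A_0X(t)+\sum_{j=1}^{m}A_jX(t-\tau_j)\quad\text{for } t\ge 0,\qquad X(t)=0\ \text{for } t<0,\qquad X(0)=I,$$ where $I$ is the identity matrix and $\dot X(t)$ is understood as the right-hand derivative (at points such as $t=0$ and $t=\tau_j$ the two-sided derivative need not exist). Asymptotic stability of the system is characterized as follows: the system is asymptotically stable if and only if there exist constants $\alpha>0$ and $\gamma>0$ such that $\|X(t)\|\le\gamma\exp(-\alpha t)$ for all $t\in[0,\infty)$, where $\|\cdot\|$ is a matrix norm. The Frobenius norm of $W=[w_{ij}]\in\mathbb{R}^{n\times n}$ is $\|W\|_F=\bigl(\sum_{i,j}w_{ij}^2\bigr)^{1/2}$, and $\int_0^\infty\|X(\sigma)\|_F^2\,d\sigma=\lim_{t\to\infty}\int_0^t\|X(\sigma)\|_F^2\,d\sigma$.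 *)

(* Defs.v *)
From HB Require Import structures.
From mathcomp Require Import all_boot all_order all_algebra.
From mathcomp Require Import all_classical all_reals all_analysis.

Set Implicit Arguments.
Unset Strict Implicit.
Unset Printing Implicit Defensive.

Import Order.TTheory GRing.Theory Num.Theory.
Import numFieldNormedType.Exports.

Local Open Scope classical_set_scope.
Local Open Scope ring_scope.

Definition frobenius_norm (R : realType) (n : nat) (W : 'M[R]_n) : R :=
  Num.sqrt (\sum_(i < n) \sum_(j < n) W i j ^+ 2).

(* Submultiplicativity is not required: any norm on the vector space of
   matrices is allowed. Nonnegativity follows from the three axioms. *)
Record is_matrix_norm (R : realType) (n : nat) (N : 'M[R]_n -> R) : Prop :=
  IsMatrixNorm {
    matrix_norm_eq0 : forall W, N W = 0 -> W = 0 ;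
    matrix_normZ : forall (a : R) W, N (a *: W) = `|a| * N W ;
    matrix_norm_triangle : forall V W, N (V + W) <= N V + N W }.

(* 0^'+ is the filter of right neighbourhoods of 0, with 0 excluded. *)
Definition has_right_derivative (R : realType) (n : nat)
    (X : R -> 'M[R]_n) (t : R) (D : 'M[R]_n) : Prop :=
  h^-1 *: (X (t + h) - X t) @[h --> 0^'+] --> D.

(* The delays tau_1, ..., tau_m and the matrices A_1, ..., A_m are indexed by
   'I_m, that is, from 0 to m - 1. *)
Record is_fundamental_matrix (R : realType) (n m : nat)
    (A0 : 'M[R]_n) (A : 'I_m -> 'M[R]_n) (tau : 'I_m -> R)
    (X : R -> 'M[R]_n) : Prop :=
  IsFundamentalMatrix {
    fundamental_continuous : {within `[0, +oo[, continuous X} ;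
    fundamental_rhs : forall t, 0 <= t ->
      has_right_derivative X t
        (A0 *m X t + \sum_(j < m) A j *m X (t - tau j)) ;
    fundamental_past : forall t, t < 0 -> X t = 0 ;
    fundamental_init : X 0 = 1%:M }.

(* The fundamental matrix is unique, so "exists X" just names it; N is the
   matrix norm in which its exponential decay is measured. *)
Definition asymptotically_stable (R : realType) (n m : nat)
    (N : 'M[R]_n -> R)
    (A0 : 'M[R]_n) (A : 'I_m -> 'M[R]_n) (tau : 'I_m -> R) : Prop :=
  exists2 X, is_fundamental_matrix A0 A tau X &
    exists alpha gamma : R,
      [/\ 0 < alpha, 0 < gamma &
          forall t, 0 <= t -> N (X t) <= gamma * expR (- alpha * t)].

Definition improper_integral_finite (R : realType) (f : R -> R) : Prop :=
  exists l : R,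
    (\int[lebesgue_measure]_(s in `[0%R, t]) (f s)%:E)%E @[t --> +oo%R]
      --> l%:E.

(* Main.v *)
Require Import Defs.
From mathcomp Require Import all_boot all_order all_algebra.
From mathcomp Require Import all_classical all_reals all_analysis.
Import Order.TTheory GRing.Theory Num.Theory.
Import numFieldNormedType.Exports.
Local Open Scope ring_scope.
From mathcomp Require Import ring lra.

(** Stability implies square integrability because the fundamental matrix is
    unique ([fundamental_unique]) and all norms on matrices are equivalent
    ([nrm_le_matrix_norm]), so the squared Frobenius norm of [X] is dominated
    by a decaying exponential.

    The converse has two parts. First, [X] tends to zero. The derivative of
    [sqsum (X t)], the squared Frobenius norm, is bounded by a constant times
    [sqsum (X t) + \sum_j sqsum (X (t - tau j))], so its growth on [[a, b]] is
    controlled by increments of the convergent energy integral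
    ([sqsum_growth]). Late increments are arbitrarily small, while finiteness
    of the energy forces [sqsum (X a)] to be small for some late [a]; hence it
    stays small from there on ([square_integrable_decay]).

    Secondly, convergence to zero improves to exponential decay, because [X]
    almost satisfies a semigroup law:
    [X (t + s) = X s * X t + \sum_j \int_t^(t + tau j)
                   X (t + s - u) * A j * X (u - tau j) du]
    ([semigroup_defect]). If [X] is small enough on the window ending at a
    fixed [s], this halves every bound on [X] that holds on a window of the
    length of the delays, at the price of a time lag depending on [s] only
    ([nrm_semigroup_defect]); iterating gives the exponential.

    The semigroup law comes from differentiating [u |-> X (T - u) * X u]. The
    derivative of [X (T - u)] has to be taken with the coefficients on the
    right of [X], that of [X u] with the coefficients on the left, so [X] must
    solve both equations. With [P] the primitive of [X] that vanishes on
    negative times, [X = 1 + A0 * P + \sum_j A j * P (t - tau j)] for [t >= 0],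
    and the same expression with the coefficients on the right solves the same
    delay equation as [X]; uniqueness identifies the two ([left_op_primitiveC]).

    One-sided derivatives and jumps at the delays are dealt with once and for
    all by a mean value inequality for continuous functions with a right
    derivative outside a finite set ([right_deriv_lip]). *)

Set Implicit Arguments.
Unset Strict Implicit.
Unset Printing Implicit Defensive.

(** * Functions of a real variable with one-sided derivatives *)

Section RealCalculus.
Local Open Scope classical_set_scope.
Variable R : realType.
Implicit Types (f g F : R -> R) (a b t d : R) (S : seq R).

Lemma continuous_subr c : continuous (fun u : R => u - c).
Proof. by move=> u; apply: cvgB; [exact: cvg_id|exact: cvg_cst]. Qed.

Lemma continuous_subl c : continuous (fun u : R => c - u).
Proof. by move=> u; apply: cvgB; [exact: cvg_cst|exact: cvg_id]. Qed.

Lemma continuous_mull c : continuous (fun u : R => c * u).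
Proof. by move=> u; apply: cvgMl_tmp; exact: cvg_id. Qed.

Lemma continuous_maxr c : continuous (fun u : R => Num.max u c).
Proof.
by move=> u; apply: (@continuous_max _ _ id (cst c)); 
  [exact: cvg_id|exact: cvg_cst].
Qed.

Definition right_deriv f t d : Prop :=
  h^-1 * (f (t + h) - f t) @[h --> 0^'+] --> d.

Lemma is_derive_right f t d : is_derive t 1 f d -> right_deriv f t d.
Proof.
move=> [df <-]; apply: cvg_dnbhs_at_right.
suff -> : (fun h => h^-1 * (f (t + h) - f t)) =
    (fun h => h^-1 *: ((f \o shift t) (h *: 1) - f t)) by exact: df.
by apply/funext => h /=; rewrite [h *: 1]mulr1 [t + h]addrC.
Qed.

Lemma right_derivB f g t d e :
  right_deriv f t d -> right_deriv g t e ->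
  right_deriv (fun u => f u - g u) t (d - e).
Proof.
move=> fd ge; rewrite /right_deriv.
suff -> : (fun h => h^-1 * (f (t + h) - g (t + h) - (f t - g t))) =
    (fun h => h^-1 * (f (t + h) - f t) - h^-1 * (g (t + h) - g t)).
  exact: cvgB.
by apply/funext => h; rewrite -mulrBr; congr (_ * _); ring.
Qed.

(** The supremum [c] of the points of [[a, b]] where [f] is at most [f a] is
    such a point by continuity, and a descending step from [c] would leave
    the supremum behind unless [c = b]. *)
Lemma le_of_descending_steps f a b : continuous f -> a <= b ->
  (forall t, a <= t -> t < b -> exists s, [/\ t < s, s <= b & f s <= f t]) ->
  f b <= f a.
Proof.
move=> cf ab step; rewrite leNgt; apply/negP => fab.
pose E := [set t | [/\ a <= t, t <= b & f t <= f a]].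
have Ea : E a by split.
have ubE : has_sup E.
  by split; [exists a | exists b => t []].
pose c := sup E.
have ac : a <= c by apply: sup_upper_bound.
have cb : c <= b.
  by apply: ge_sup; [exists a | move=> t []].
have fc : f c <= f a.
  rewrite leNgt; apply/negP => fac.
  have : \forall t \near c, f a < f t by exact: (cf c _ (lt_nbhsr fac)).
  move=> /nbhs_ballP[e /= e0 he].
  have [t Et ct] := sup_adherent e0 ubE.
  have tc : t <= c by apply: sup_upper_bound.
  have [_ _ fta] := Et.
  have : f a < f t.
    by apply: he; rewrite /ball /= ger0_norm ?subr_ge0// ltrBlDr -ltrBlDl.
  by rewrite ltNge fta.
have {}cb : c < b.
  by rewrite lt_neqAle cb andbT; apply: contraTN fab => /eqP <-; rewrite -leNgt.
have [s [cs sb fs]] := step c ac cb.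
suff: s <= c by rewrite leNgt cs.
apply: sup_upper_bound => //; split => //; last exact: le_trans fs fc.
by rewrite (le_trans ac (ltW cs)).
Qed.

(** A finite exceptional set costs nothing: cut the interval at its points.
    The left end point of a piece is reached by continuity. *)
Lemma right_deriv_le0 f S a b : continuous f -> a <= b ->
  (forall t, a < t -> t < b -> t \notin S ->
     exists2 d, right_deriv f t d & d <= 0) ->
  f b <= f a.
Proof.
move=> cf; elim: S a b => [|s S IH] a b ab df; last first.
  have [/andP[as_ sb]|] := boolP ((a < s) && (s < b)).
    apply: (@le_trans _ _ (f s)); apply: IH; rewrite ?ltW// => t ta tb tS.
      by apply: df => //; [exact: lt_trans as_ ta|rewrite inE negb_or tS gt_eqF].
    by apply: df => //; [exact: lt_trans tb sb|rewrite inE negb_or tS lt_eqF].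
  move=> nab; apply: IH => // t ta tb tS; apply: df => //.
  by rewrite inE negb_or tS andbT; apply: contraNneq nab => <-; rewrite ta.
have inner a' : a < a' -> a' <= b -> f b <= f a'.
  move=> aa' a'b; apply/ler_addgt0Pr => e e0.
  (* Tilting [f] by the slope [e'] makes the right derivative negative. *)
  pose e' := e / (b - a' + 1).
  have e'0 : 0 < e' by rewrite divr_gt0// ltr_wpDl// subr_ge0.
  have : f b - e' * b <= f a' - e' * a'.
    apply: (@le_of_descending_steps (fun t => f t - e' * t)) => //.
      by move=> t; apply: cvgB; [exact: cf|exact: continuous_mull].
    move=> t a't tb.
    have [d dd d0] := df t (lt_le_trans aa' a't) tb isT.
    have /cvgrPdist_lt/(_ e' e'0) := dd => hd.
    near (0%R : R)^'+ => h.
    have h0 : 0 < h by near: h; exact: nbhs_right_gt.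
    exists (t + h); split; first by rewrite ltrDl.
      by rewrite -lerBrDl; near: h; apply: nbhs_right_le; rewrite subr_gt0.
    have : `|d - h^-1 * (f (t + h) - f t)| < e' by near: h.
    rewrite ltr_distlC => /andP[_ /ltW].
    rewrite mulrC ler_pdivrMr// => hh.
    have : (d + e') * h <= e' * h by rewrite ler_pM2r//; lra.
    lra.
  have : e' * (b - a') <= e.
    rewrite /e' mulrAC ler_pdivrMr ?ltr_wpDl ?subr_ge0// ler_pM2l//.
    by rewrite lerDl.
  lra.
have [->//|] := eqVneq a b; move=> nab.
have {nab}ab : a < b by rewrite lt_neqAle nab.
rewrite leNgt; apply/negP => fab.
have : \forall t \near a, f t < f b by exact: (cf a _ (lt_nbhsl fab)).
move=> na.
have {}na : \forall t \near a^'+, f t < f b by apply: cvg_within na.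
near a^'+ => t.
have : f b <= f t.
  by apply: inner; near: t; [exact: nbhs_right_gt|exact: nbhs_right_le].
by apply/negP; rewrite -ltNge; near: t.
Unshelve. all: by end_near. Qed.

Lemma right_deriv_lip f S a b K : continuous f -> a <= b ->
  (forall t, a < t -> t < b -> t \notin S ->
     exists2 d, right_deriv f t d & `|d| <= K) ->
  `|f b - f a| <= K * (b - a).
Proof.
move=> cf ab df.
have dK (c t : R) : right_deriv (fun u => c * u) t c.
  apply: is_derive_right.
  apply: (is_derive_eq (is_deriveZ c (is_derive_id t (1 : R)))).
  exact: mulr1.
rewrite ler_norml; apply/andP; split.
- have : - K * b - f b <= - K * a - f a.
    apply: (@right_deriv_le0 (fun u => - K * u - f u) S) => //.
      by move=> u; apply: cvgB; [exact: continuous_mull|exact: cf].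
    move=> t ta tb tS; have [d dd dK'] := df t ta tb tS.
    exists (- K - d); first exact: right_derivB.
    by move: dK'; rewrite ler_norml => /andP[]; lra.
  lra.
- have : f b - K * b <= f a - K * a.
    apply: (@right_deriv_le0 (fun u => f u - K * u) S) => //.
      by move=> u; apply: cvgB; [exact: cf|exact: continuous_mull].
    move=> t ta tb tS; have [d dd dK'] := df t ta tb tS.
    exists (d - K); first exact: right_derivB.
    by move: dK'; rewrite ler_norml => /andP[]; lra.
  lra.
Qed.

(** The extension of the primitive by 0 to negative times matches solutions
    of delay systems that vanish there. *)
Lemma causal_primitive f : continuous f -> exists F,
  [/\ continuous F, forall t, t <= 0 -> F t = 0,
      forall t, 0 < t -> is_derive t 1 F (f t) &
      forall t, 0 <= t ->
        (\int[lebesgue_measure]_(s in `[0%R, t]) (f s)%:E)%E = (F t)%:E].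
Proof.
move=> cf.
(* The base point -1 makes [G] differentiable on both sides of 0. *)
pose G (x : R) : R := (\int[lebesgue_measure]_(s in `[(-1)%R, x]) f s)%R.
have dG (x : R) : -1 < x -> is_derive x 1 G (f x).
  move=> x1.
  have [||dGx <-] := @continuous_FTC1_closed R f (-1) x (x + 1) _ _ x1 (cf x).
  - by rewrite ltrDl.
  - apply: continuous_compact_integrable; first exact: segment_compact.
    exact: continuous_subspaceT.
  - by rewrite derive1E; exact: derivableP.
have cG (x : R) : -1 < x -> {for x, continuous G}.
  by move=> /dG [dGx _]; exact/differentiable_continuous/derivable1_diffP.
pose F (x : R) : R := G (Num.max x 0) - G 0.
have cF : continuous F.
  move=> x; apply: cvgB; last exact: cvg_cst.
  apply: (@continuous_comp _ _ _ (fun x : R => Num.max x 0) G).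
    exact: continuous_maxr.
  by apply: cG; rewrite lt_max; apply/orP; right; lra.
have F0 (t : R) : t <= 0 -> F t = 0 by move=> t0; rewrite /F max_r// subrr.
have dF (t : R) : 0 < t -> is_derive t 1 F (f t).
  move=> t0.
  have t1 : -1 < t by lra.
  have dGt := dG t t1.
  have dGc : is_derive t 1 (G - cst (G 0)) (f t).
    by apply: is_derive_eq; rewrite subr0.
  apply: near_eq_is_derive dGc.
  by near=> y; rewrite /F max_l// ltW//; near: y; exact: lt_nbhsr.
exists F; split => // t; rewrite le_eqVlt => /predU1P[<-|t0].
  by rewrite set_itv1 integral_set1 F0.
have -> : (F t)%:E = ((F t)%:E - (F 0)%:E)%E by rewrite -EFinB (F0 0)// subr0.
apply: (@continuous_FTC2 _ f F 0 t t0).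
- exact: continuous_subspaceT.
- split.
  + by move=> x; rewrite in_itv /= => /andP[x0 _]; have [] := dF x x0.
  + exact/cvg_at_right_filter/cF.
  + exact/cvg_at_left_filter/cF.
- move=> x; rewrite in_itv /= => /andP[x0 _]; rewrite derive1E.
  by have [_ ->] := dF x x0.
Unshelve. all: by end_near. Qed.

End RealCalculus.

(** * Matrix functions, differentiated entry by entry *)

Section MatrixCalculus.
Local Open Scope classical_set_scope.
Variables (R : realType) (n : nat).
Implicit Types (F G : R -> 'M[R]_n) (D V W : 'M[R]_n) (a b t : R) (S : seq R).

(** The sum of the absolute values of the entries is submultiplicative, and
    bounds on it follow from scalar bounds on the entries. *)
Definition nrm W : R := \sum_i \sum_j `|W i j|.

Lemma nrm_ge0 W : 0 <= nrm W.
Proof. by apply: sumr_ge0 => i _; apply: sumr_ge0. Qed.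

Lemma nrm0 : nrm 0 = 0.
Proof. by apply: big1 => i _; apply: big1 => j _; rewrite mxE normr0. Qed.

Lemma entry_le_nrm W i j : `|W i j| <= nrm W.
Proof.
rewrite /nrm (bigD1 i)//= (bigD1 j)//= -addrA lerDl addr_ge0//.
  exact: sumr_ge0.
by apply: sumr_ge0 => k _; apply: sumr_ge0.
Qed.

Lemma nrm_eq0 W : nrm W <= 0 -> W = 0.
Proof.
move=> W0; apply/matrixP => i j; rewrite mxE; apply/eqP.
by rewrite -normr_le0 (le_trans (entry_le_nrm _ _ _)).
Qed.

Lemma nrmD V W : nrm (V + W) <= nrm V + nrm W.
Proof.
rewrite /nrm -big_split; apply: ler_sum => i _; rewrite -big_split.
by apply: ler_sum => j _; rewrite mxE ler_normD.
Qed.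

Lemma nrm_sum (I : finType) (f : I -> 'M[R]_n) :
  nrm (\sum_i f i) <= \sum_i nrm (f i).
Proof.
elim/big_ind2 : _ => [|x V y W xV yW|//]; first by rewrite nrm0.
exact: le_trans (nrmD _ _) (lerD xV yW).
Qed.

Lemma nrmM V W : nrm (V *m W) <= nrm V * nrm W.
Proof.
rewrite /nrm mulr_suml; apply: ler_sum => i _.
apply: (@le_trans _ _ (\sum_j \sum_k `|V i k| * `|W k j|)).
  apply: ler_sum => j _; rewrite mxE; apply: le_trans (ler_norm_sum _ _ _) _.
  by apply: ler_sum => k _; rewrite normrM.
rewrite exchange_big mulr_suml; apply: ler_sum => k _.
rewrite -mulr_sumr ler_wpM2l//.
by rewrite [leRHS](bigD1 k)//= lerDl; apply: sumr_ge0 => l _; apply: sumr_ge0.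
Qed.

Lemma sum_entries_const (K : R) :
  \sum_(i < n) \sum_(j < n) K = n%:R ^+ 2 * K.
Proof. by rewrite !sumr_const !card_ord -mulrnA -[LHS]mulr_natl natrM -expr2. Qed.

Definition mxcont F := forall i j, continuous (fun t => F t i j).

Lemma mxcont_cst W : mxcont (fun=> W).
Proof. by move=> i j t; exact: cvg_cst. Qed.

Lemma mxcontD F G : mxcont F -> mxcont G -> mxcont (fun t => F t + G t).
Proof.
move=> cF cG i j; under eq_fun do rewrite mxE.
by move=> t; apply: cvgD; [exact: cF|exact: cG].
Qed.

Lemma mxcontN F : mxcont F -> mxcont (fun t => - F t).
Proof.
by move=> cF i j; under eq_fun do rewrite mxE; move=> t; apply: cvgN; exact: cF.
Qed.

Lemma mxcontB F G : mxcont F -> mxcont G -> mxcont (fun t => F t - G t).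
Proof. by move=> cF cG; apply: mxcontD cF (mxcontN cG). Qed.

Lemma continuous_bigsum (I : Type) (r : seq I) (f : I -> R -> R) :
  (forall i, continuous (f i)) -> continuous (fun t => \sum_(i <- r) f i t).
Proof.
move=> cf; elim: r => [|i r IH] t.
  by under eq_fun do rewrite big_nil; exact: cvg_cst.
by under eq_fun do rewrite big_cons; apply: cvgD; [exact: cf|exact: IH].
Qed.

Lemma mxcont_sum (I : finType) (H : I -> R -> 'M[R]_n) :
  (forall k, mxcont (H k)) -> mxcont (fun t => \sum_k H k t).
Proof.
move=> cH i j; under eq_fun do rewrite summxE.
by apply: continuous_bigsum => k; exact: cH.
Qed.

Lemma mxcontM F G : mxcont F -> mxcont G -> mxcont (fun t => F t *m G t).
Proof.
move=> cF cG i j; under eq_fun do rewrite mxE.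
apply: continuous_bigsum => k t.
by apply: cvgM; [exact: cF|exact: cG].
Qed.

Lemma mxcont_comp F (g : R -> R) : continuous g -> mxcont F -> mxcont (F \o g).
Proof.
move=> cg cF i j t.
exact: (@continuous_comp _ _ _ g (fun u => F u i j) t (cg t) (cF i j (g t))).
Qed.

Lemma nrm_cont F : mxcont F -> continuous (fun t => nrm (F t)).
Proof.
move=> cF; apply: continuous_bigsum => i; apply: continuous_bigsum => j t.
by apply: cvg_norm; exact: cF.
Qed.

Definition mxderiv F t D :=
  forall i j, is_derive t 1 (fun u => F u i j) (D i j).

Definition mxrderiv F t D :=
  forall i j, right_deriv (fun u => F u i j) t (D i j).

Lemma mxderiv_right F t D : mxderiv F t D -> mxrderiv F t D.
Proof. by move=> dF i j; exact: is_derive_right. Qed.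

Lemma mxderiv_cst W t : mxderiv (fun=> W) t 0.
Proof. by move=> i j; rewrite mxE; exact: is_derive_cst. Qed.

Lemma mxderivD F G t D W :
  mxderiv F t D -> mxderiv G t W -> mxderiv (fun u => F u + G u) t (D + W).
Proof.
move=> dF dG i j; rewrite mxE; under eq_fun do rewrite mxE.
exact: (is_deriveD (dF i j) (dG i j)).
Qed.

Lemma mxderivB F G t D W :
  mxderiv F t D -> mxderiv G t W -> mxderiv (fun u => F u - G u) t (D - W).
Proof.
move=> dF dG i j; rewrite !mxE; under eq_fun do rewrite !mxE.
exact: (is_deriveB (dF i j) (dG i j)).
Qed.

Lemma mxrderivB F G t D W :
  mxrderiv F t D -> mxrderiv G t W -> mxrderiv (fun u => F u - G u) t (D - W).
Proof.
move=> dF dG i j; rewrite !mxE /right_deriv; under eq_fun do rewrite !mxE.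
exact: (right_derivB (dF i j) (dG i j)).
Qed.

Lemma is_derive_bigsum (I : Type) (r : seq I) (f : I -> R -> R) t (d : I -> R) :
  (forall i, is_derive t 1 (f i) (d i)) ->
  is_derive t 1 (fun u => \sum_(i <- r) f i u) (\sum_(i <- r) d i).
Proof.
move=> df; elim: r => [|i r IH].
  by rewrite big_nil; under eq_fun do rewrite big_nil; exact: is_derive_cst.
rewrite big_cons; under eq_fun do rewrite big_cons.
exact: (is_deriveD (df i) IH).
Qed.

Lemma mxderiv_sum (I : finType) (H : I -> R -> 'M[R]_n) t (D : I -> 'M[R]_n) :
  (forall k, mxderiv (H k) t (D k)) ->
  mxderiv (fun u => \sum_k H k u) t (\sum_k D k).
Proof.
move=> dH i j; rewrite summxE; under eq_fun do rewrite summxE.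
by apply: is_derive_bigsum => k; exact: dH.
Qed.

Lemma mxderivM F G t D W : mxderiv F t D -> mxderiv G t W ->
  mxderiv (fun u => F u *m G u) t (D *m G t + F t *m W).
Proof.
move=> dF dG i j; rewrite !mxE -big_split/=; under eq_fun do rewrite mxE.
apply: is_derive_bigsum => k.
apply: (is_derive_eq (is_deriveM (dF i k) (dG k j))).
by rewrite /GRing.scale /=; ring.
Qed.

Lemma mxderivMl V F t D :
  mxderiv F t D -> mxderiv (fun u => V *m F u) t (V *m D).
Proof.
by move=> /(mxderivM (mxderiv_cst V t)); rewrite mul0mx add0r.
Qed.

Lemma mxderivMr V F t D :
  mxderiv F t D -> mxderiv (fun u => F u *m V) t (D *m V).
Proof.
by move=> /mxderivM /(_ (mxderiv_cst V t)); rewrite mulmx0 addr0.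
Qed.

Lemma mxderiv_shift F c t D :
  mxderiv F (t + c) D -> mxderiv (fun u => F (u + c)) t D.
Proof.
move=> dF i j.
rewrite -[D i j]mulr1.
exact: (@is_derive1_comp _ (fun u => F u i j) (shift c) _ _ _ (dF i j)
  (is_derive_shift t 1 c)).
Qed.

Lemma mxderiv_reflect F c t D :
  mxderiv F (c - t) D -> mxderiv (fun u => F (c - u)) t (- D).
Proof.
move=> dF i j.
have dg : is_derive t 1 (fun u : R => c - u) (-1).
  apply: (is_derive_eq (is_deriveB (is_derive_cst c t 1) (is_derive_id t 1))).
  by rewrite sub0r.
rewrite mxE -mulrN1.
exact: (@is_derive1_comp _ (fun u => F u i j) (fun u => c - u) _ _ _ (dF i j) dg).
Qed.

Lemma mxderiv_near F G t D :
  (\near t, F t = G t) -> mxderiv F t D -> mxderiv G t D.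
Proof.
move=> FG dF i j; apply: near_eq_is_derive (dF i j).
by near=> u; rewrite (near FG u).
Unshelve. all: by end_near. Qed.

(** The factor [n ^ 2] comes from applying the scalar inequality to each
    entry separately. *)
Lemma mx_mean_value F S a b K : mxcont F -> a <= b ->
  (forall t, a < t -> t < b -> t \notin S ->
     exists2 D, mxrderiv F t D & nrm D <= K) ->
  nrm (F b - F a) <= n%:R ^+ 2 * (K * (b - a)).
Proof.
move=> cF ab dF; rewrite /nrm.
apply: (@le_trans _ _ (\sum_(i < n) \sum_(j < n) K * (b - a))); last first.
  by rewrite sum_entries_const.
apply: ler_sum => i _; apply: ler_sum => j _; rewrite !mxE.
apply: (right_deriv_lip (S := S) (cF i j) ab) => t ta tb tS.
have [D dD DK] := dF t ta tb tS.
by exists (D i j) => //; exact: le_trans (entry_le_nrm _ _ _) DK.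
Qed.

Lemma mx_constant F S a b : mxcont F -> a <= b ->
  (forall t, a < t -> t < b -> t \notin S -> mxrderiv F t 0) -> F b = F a.
Proof.
move=> cF ab dF; apply/subr0_eq/nrm_eq0.
have -> : 0 = n%:R ^+ 2 * (0 * (b - a)) :> R by rewrite mul0r mulr0.
apply: (mx_mean_value (S := S)) => // t ta tb tS.
by exists 0; [exact: dF|rewrite nrm0].
Qed.

Lemma mx_causal_primitive F : mxcont F -> exists P,
  [/\ mxcont P, forall t, t <= 0 -> P t = 0 &
      forall t, 0 < t -> mxderiv P t (F t)].
Proof.
move=> cF; pose prim (ij : 'I_n * 'I_n) (f : R -> R) :=
  [/\ continuous f, forall t, t <= 0 -> f t = 0 &
      forall t, 0 < t -> is_derive t 1 f (F t ij.1 ij.2)].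
have /choice[p pP] : forall ij, exists f, prim ij f.
  by move=> [i j]; have [f [cf f0 df _]] := causal_primitive (cF i j); exists f.
exists (fun t => \matrix_(i, j) p (i, j) t); split.
- by move=> i j; under eq_fun do rewrite mxE; have [] := pP (i, j).
- by move=> t t0; apply/matrixP => i j; rewrite !mxE; have [_ ->] := pP (i, j).
- move=> t t0 i j; under eq_fun do rewrite mxE.
  by have [_ _ /(_ t t0)] := pP (i, j).
Qed.

End MatrixCalculus.

(** * Linear delay systems and their fundamental matrix *)

Section DelaySystem.
Local Open Scope classical_set_scope.
Variables (R : realType) (n m : nat) (A0 : 'M[R]_n) (A : 'I_m -> 'M[R]_n).
Variables (tau : 'I_m -> R).
Hypothesis tau_gt0 : forall j, 0 < tau j.
Implicit Types (F E X P : R -> 'M[R]_n) (S : seq R) (s t u K : R).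

Definition delays : seq R := [seq tau j | j : 'I_m].

Lemma notin_delays t j : t \notin delays -> t != tau j.
Proof. by apply: contraNneq => ->; apply/mapP; exists j; rewrite ?mem_enum. Qed.

(** The delay equation is [X' = left_op X]. *)
Definition left_op F t := A0 *m F t + \sum_j A j *m F (t - tau j).

(** The transposed equation [X' = right_op X] turns out to have the same
    fundamental matrix. *)
Definition right_op F t := F t *m A0 + \sum_j F (t - tau j) *m A j.

Definition coef_norm : R := nrm A0 + \sum_j nrm (A j).

Lemma coef_norm_ge0 : 0 <= coef_norm.
Proof. by rewrite addr_ge0 ?nrm_ge0// sumr_ge0// => j _; exact: nrm_ge0. Qed.

Lemma nrm_left_op F t K : nrm (F t) <= K ->
  (forall j, nrm (F (t - tau j)) <= K) ->
  nrm (left_op F t) <= coef_norm * K.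
Proof.
move=> F0 Fj; apply: le_trans (nrmD _ _) _; rewrite mulrDl lerD//.
  by apply: le_trans (nrmM _ _) _; rewrite ler_wpM2l ?nrm_ge0.
apply: le_trans (nrm_sum _) _; rewrite mulr_suml; apply: ler_sum => j _.
by apply: le_trans (nrmM _ _) _; rewrite ler_wpM2l ?nrm_ge0.
Qed.

Lemma left_opB F G t :
  left_op (fun v => F v - G v) t = left_op F t - left_op G t.
Proof.
rewrite /left_op mulmxBr opprD addrACA -sumrB; congr (_ + _).
by apply: eq_bigr => j _; rewrite mulmxBr.
Qed.

(** On an interval of length [delta] beyond a point up to which [E] vanishes,
    the mean value inequality bounds the maximum of [nrm E] by half of itself;
    so the zero set advances by steps of length [delta]. *)
Lemma delay_unique E S : mxcont E -> (forall t, t <= 0 -> E t = 0) ->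
  (forall t, 0 < t -> t \notin S -> mxrderiv E t (left_op E t)) ->
  forall t, E t = 0.
Proof.
move=> cE E0 dE.
pose c := n%:R ^+ 2 * coef_norm.
have c0 : 0 <= c by rewrite mulr_ge0 ?exprn_ge0 ?coef_norm_ge0.
pose delta := (2 * (c + 1))^-1.
have d0 : 0 < delta by rewrite invr_gt0; lra.
have cd : c * delta <= 2^-1.
  by rewrite /delta invfM mulrCA ler_piMr ?invr_ge0// ler_pdivrMr; lra.
suff step (k : nat) t : t <= k%:R * delta -> E t = 0.
  move=> t; apply: (step (Num.truncn (t / delta)).+1).
  by rewrite -ler_pdivrMr// ltW// real_truncnS_gt// num_real.
elim: k t => [|k IH] t; first by rewrite mul0r; exact: E0.
set a := k%:R * delta in IH; set b := k.+1%:R * delta => tb.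
have ab : b = a + delta by rewrite /a /b -addn1 natrD; ring.
have a0 : 0 <= a by rewrite mulr_ge0// ltW.
have [ta|/ltW at_] := leP t a; first exact: IH.
have leab : a <= b by lra.
have [v vab vmax] := EVT_max leab (continuous_subspaceT (nrm_cont cE)).
set M := nrm (E v) in vmax.
have M0 : 0 <= M := nrm_ge0 _.
have Emax u : u <= b -> nrm (E u) <= M.
  move=> ub; have [/IH ->|/ltW au] := leP u a; first by rewrite nrm0.
  by apply: vmax; rewrite in_itv /= au.
move: vab; rewrite in_itv /= => /andP[av vb].
have : M <= n%:R ^+ 2 * (coef_norm * M * (v - a)).
  have {1}-> : M = nrm (E v - E a) by rewrite (IH a)// subr0.
  apply: (mx_mean_value (S := S)) => // u au uv uS.
  exists (left_op E u); first by apply: dE => //; exact: le_lt_trans au.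
  apply: nrm_left_op => [|j]; apply: Emax; first by lra.
  by have := tau_gt0 j; lra.
have -> : n%:R ^+ 2 * (coef_norm * M * (v - a)) = c * (v - a) * M.
  by rewrite /c; ring.
have : c * (v - a) <= 2^-1.
  by apply: le_trans cd; rewrite ler_wpM2l//; lra.
move=> /(ler_wpM2r M0) h1 h2.
apply/nrm_eq0/(le_trans (Emax t tb)); lra.
Qed.

(** The jump of a fundamental matrix at time 0. *)
Definition unit_step t : 'M[R]_n := ((0 <= t)%R%:R)%:M.

Section FundamentalMatrix.
Variable X : R -> 'M[R]_n.
Hypothesis hX : is_fundamental_matrix A0 A tau X.

(** The jump at 0 is removed by continuing [X] to the left by its value at 0;
    the result is continuous on the whole line. *)
Definition Xplus t := X (Num.max t 0).

Lemma Xplus_ge0 t : 0 <= t -> Xplus t = X t.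
Proof. by move=> t0; rewrite /Xplus max_l. Qed.

Lemma Xplus_cont : mxcont Xplus.
Proof.
have cX := (subspace_continuousP _ X).1 (fundamental_continuous hX).
move=> i j t.
have cXt : Xplus u @[u --> t] --> Xplus t.
  have ge0 u : (`[0, +oo[ : set R) (Num.max u 0).
    by rewrite /= in_itv /= le_max lexx orbT.
  move=> U /(cX _ (ge0 t)) /= nU.
  have nU' : \near t, (`[0, +oo[ : set R) (Num.max t 0) -> U (Xplus t).
    exact: (continuous_maxr nU).
  by apply: filterS nU' => u; apply; exact: ge0.
exact: (@continuous_comp _ _ _ Xplus (fun W : 'M[R]_n => W i j) t cXt
  (@coord_continuous R n n i j _)).
Qed.

Lemma Xplus_right_deriv t : 0 <= t -> mxrderiv Xplus t (left_op X t).
Proof.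
move=> t0 i j.
have := fundamental_rhs hX t0; rewrite /has_right_derivative -/(left_op X t) => h.
have := cvg_comp _ _ h (@coord_continuous R n n i j (left_op X t)).
apply: cvg_trans; apply: near_eq_cvg; near=> u => /=.
rewrite !mxE !Xplus_ge0// addr_ge0//.
Unshelve. all: by end_near. Qed.

Definition primitive_of P := [/\ mxcont P, forall t, t <= 0 -> P t = 0 &
  forall t, t != 0 -> mxderiv P t (X t)].

Lemma fundamental_primitive : exists P, primitive_of P.
Proof.
have [P [cP P0 dP]] := mx_causal_primitive Xplus_cont.
exists P; split=> // t; rewrite neq_lt => /orP[t0|t0]; last first.
  by rewrite -Xplus_ge0 ?(ltW t0)//; exact: dP.
rewrite (fundamental_past hX t0).
apply: mxderiv_near (mxderiv_cst 0 t).
by near=> u; rewrite P0// ltW//; near: u; exact: lt_nbhsl.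
Unshelve. all: by end_near. Qed.

Lemma primitive_shift_deriv P t : primitive_of P -> 0 < t -> t \notin delays ->
  forall j, mxderiv (fun u => P (u - tau j)) t (X (t - tau j)).
Proof.
move=> [_ _ dP] t0 td j; apply: mxderiv_shift; apply: dP.
by rewrite subr_eq0 notin_delays.
Qed.

(** Both sides are continuous, agree at 0 and have the same right derivative
    at all positive times except the delays. *)
Lemma Xplus_integral P : primitive_of P ->
  forall t, Xplus t = 1%:M + left_op P t.
Proof.
move=> pP t; have [cP P0 dP] := pP.
have crhs : mxcont (left_op P).
  apply: mxcontD; first by apply: mxcontM => //; exact: mxcont_cst.
  apply: mxcont_sum => j; apply: mxcontM; first exact: mxcont_cst.
  by apply: (mxcont_comp (g := fun u => u - tau j)) => //; exact: continuous_subr.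
have rhs0 u : u <= 0 -> left_op P u = 0.
  move=> u0; rewrite /left_op P0// mulmx0 add0r big1// => j _.
  by rewrite P0 ?mulmx0//; have := tau_gt0 j; lra.
have [t0|/ltW t0] := leP t 0.
  by rewrite rhs0// addr0 /Xplus max_r// (fundamental_init hX).
apply/eqP; rewrite -subr_eq; apply/eqP.
suff -> : Xplus t - left_op P t = Xplus 0 - left_op P 0.
  by rewrite rhs0// subr0 Xplus_ge0// (fundamental_init hX).
apply: (mx_constant (F := fun u => Xplus u - left_op P u) (S := delays)) => //.
  by apply: mxcontB => //; exact: Xplus_cont.
move=> u u0 _ ud; rewrite -(subrr (left_op X u)); apply: mxrderivB.
  by apply: Xplus_right_deriv; exact: ltW.
apply: mxderiv_right; apply: mxderivD.
  by apply: mxderivMl; apply: dP; rewrite gt_eqF.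
by apply: mxderiv_sum => j; apply: mxderivMl; exact: primitive_shift_deriv.
Qed.

Lemma X_integral P : primitive_of P ->
  forall t, X t = unit_step t + left_op P t.
Proof.
move=> pP t; rewrite /unit_step; have [t0|t0] := leP 0 t.
  by rewrite -Xplus_ge0// (Xplus_integral pP).
rewrite (fundamental_past hX t0) mulr0n raddf0 add0r.
have := Xplus_integral pP t.
rewrite /Xplus max_r ?(ltW t0)// (fundamental_init hX) => /eqP.
by rewrite -subr_eq0 opprD addrA subrr sub0r oppr_eq0 => /eqP ->.
Qed.

(** Convolution with the two kernels commutes: inserting
    [X = unit_step + left_op P] on the right-hand side produces the same double
    sum [\sum_j \sum_i A j * P (t - tau j - tau i) * A i] as the left-hand
    side. *)
Lemma left_op_right_op P t : primitive_of P ->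
  left_op (fun u => unit_step u + right_op P u) t = right_op X t.
Proof.
move=> pP.
have -> : X = fun v => unit_step v + left_op P v by apply/funext; exact: X_integral.
have sC u W : unit_step u *m W = W *m unit_step u.
  by rewrite /unit_step mul_scalar_mx mul_mx_scalar.
rewrite /left_op /right_op.
transitivity (A0 *m unit_step t + A0 *m P t *m A0 +
  \sum_i A0 *m P (t - tau i) *m A i + (\sum_j A j *m unit_step (t - tau j) +
  \sum_j A j *m P (t - tau j) *m A0 +
  \sum_j \sum_i A j *m P (t - tau j - tau i) *m A i)).
  rewrite !mulmxDr mulmx_sumr mulmxA -!addrA; congr (_ + (_ + (_ + _))).
    by apply: eq_bigr => i _; rewrite mulmxA.
  rewrite -!big_split /=; apply: eq_bigr => j _.
  rewrite !mulmxDr mulmx_sumr mulmxA; congr (_ + (_ + _)).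
  by apply: eq_bigr => i _; rewrite mulmxA.
rewrite !mulmxDl sC mulmx_suml.
have -> : \sum_j (unit_step (t - tau j) + (A0 *m P (t - tau j) +
      \sum_i A i *m P (t - tau j - tau i))) *m A j =
    \sum_j A j *m unit_step (t - tau j) + \sum_i A0 *m P (t - tau i) *m A i +
    \sum_j \sum_i A j *m P (t - tau j - tau i) *m A i.
  rewrite [X in _ = _ + X]exchange_big -!big_split /=; apply: eq_bigr => j _.
  rewrite !mulmxDl sC mulmx_suml -addrA; congr (_ + (_ + _)).
  by apply: eq_bigr => i _; rewrite addrAC.
rewrite -!addrA; congr (_ + (_ + _)).
by rewrite addrCA [RHS]addrCA; congr (_ + _); rewrite addrCA.
Qed.

(** By [left_op_right_op] both [unit_step + left_op P], which is [X], and
    [unit_step + right_op P] solve the delay equation with the coefficients on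
    the left. Their difference is continuous and vanishes up to time 0, so it
    is zero by uniqueness. *)
Lemma left_op_primitiveC P : primitive_of P ->
  forall t, left_op P t = right_op P t.
Proof.
move=> pP t; have [cP P0 dP] := pP; apply/subr0_eq.
have cshift j : mxcont (fun u => P (u - tau j)).
  by apply: (mxcont_comp (g := fun u => u - tau j)) => //; exact: continuous_subr.
apply: (@delay_unique (fun u => left_op P u - right_op P u) delays)
  => [|u u0|u u0 ud].
- apply: mxcontB; apply: mxcontD.
  + by apply: mxcontM => //; exact: mxcont_cst.
  + by apply: mxcont_sum => j; apply: mxcontM => //; exact: mxcont_cst.
  + by apply: mxcontM => //; exact: mxcont_cst.
  + by apply: mxcont_sum => j; apply: mxcontM => //; exact: mxcont_cst.
- have Pj j : P (u - tau j) = 0 by apply: P0; have := tau_gt0 j; lra.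
  rewrite /left_op /right_op P0// mulmx0 mul0mx !add0r.
  by rewrite !big1 ?subr0// => j _; rewrite Pj ?mulmx0 ?mul0mx.
- have -> : left_op (fun v => left_op P v - right_op P v) u =
      left_op X u - right_op X u.
    rewrite -(left_op_right_op u pP).
    have XE v : left_op P v - right_op P v = X v - (unit_step v + right_op P v).
      rewrite (X_integral pP); move: (left_op P v) (right_op P v) => V W.
      by rewrite opprD addrACA subrr add0r.
    by rewrite -left_opB; congr (left_op _ u); exact/funext.
  apply: mxderiv_right; apply: mxderivB; apply: mxderivD.
  + by apply: mxderivMl; apply: dP; rewrite gt_eqF.
  + by apply: mxderiv_sum => j; apply: mxderivMl; exact: primitive_shift_deriv.
  + by apply: mxderivMr; apply: dP; rewrite gt_eqF.
  + by apply: mxderiv_sum => j; apply: mxderivMr; exact: primitive_shift_deriv.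
Qed.

Lemma Xplus_deriv t : 0 < t -> t \notin delays ->
  mxderiv Xplus t (left_op X t) /\ mxderiv Xplus t (right_op X t).
Proof.
move=> t0 td; have [P pP] := fundamental_primitive; have [_ _ dP] := pP.
have XE : Xplus = fun u => 1%:M + left_op P u.
  by apply/funext => u; exact: Xplus_integral.
have XE' : Xplus = fun u => 1%:M + right_op P u.
  by rewrite XE; apply/funext => u; rewrite left_op_primitiveC.
split.
- rewrite XE -[left_op X t]add0r; apply: mxderivD; first exact: mxderiv_cst.
  apply: mxderivD; first by apply: mxderivMl; apply: dP; rewrite gt_eqF.
  by apply: mxderiv_sum => j; apply: mxderivMl; exact: primitive_shift_deriv.
- rewrite XE' -[right_op X t]add0r; apply: mxderivD; first exact: mxderiv_cst.
  apply: mxderivD; first by apply: mxderivMr; apply: dP; rewrite gt_eqF.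
  by apply: mxderiv_sum => j; apply: mxderivMr; exact: primitive_shift_deriv.
Qed.

(** The integrand is cut off outside [[tau j, T]] by the two factors, and is
    continuous inside; so a primitive [Q] of its continuous extension, composed
    with the projection to [[tau j, T]], is a primitive of it. When
    [T < tau j], the projection is constant and the integrand is zero. *)
Lemma convolution_primitive j T : exists H : R -> 'M[R]_n,
  [/\ mxcont H, H (tau j) = H 0 & forall u, u != tau j -> u != T ->
      mxderiv H u (X (T - u) *m A j *m X (u - tau j))].
Proof.
pose f u := Xplus (T - u) *m A j *m Xplus (u - tau j).
have cf : mxcont f.
  apply: mxcontM; first apply: mxcontM; first 2 [exact: mxcont_cst].
  - by apply: (mxcont_comp (g := fun u => T - u)) Xplus_cont; exact: continuous_subl.
  - apply: (mxcont_comp (g := fun u => u - tau j)) Xplus_cont.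
    exact: continuous_subr.
have [Q [cQ _ dQ]] := mx_causal_primitive cf.
have tj := tau_gt0 j.
exists (fun u => Q (Num.min (Num.max u (tau j)) T)); split.
- apply: (mxcont_comp (g := fun u => Num.min (Num.max u (tau j)) T)) cQ => u.
  apply: (@continuous_min _ _ (fun u => Num.max u (tau j)) (cst T)); last exact: cvg_cst.
  exact: continuous_maxr.
- by rewrite maxxx max_r// ltW.
move=> u; rewrite neq_lt => /orP[uj _|uj].
  rewrite (fundamental_past hX (_ : u - tau j < 0)) ?subr_lt0// mulmx0.
  apply: mxderiv_near (mxderiv_cst (Q (Num.min (tau j) T)) u).
  by near=> v; rewrite max_r// ltW//; near: v; exact: lt_nbhsl.
rewrite neq_lt => /orP[uT|Tu].
  rewrite -!Xplus_ge0 ?subr_ge0 ?(ltW uT) ?(ltW uj)//.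
  apply: mxderiv_near (dQ u (lt_trans tj uj)).
  near=> v; rewrite max_l; last by rewrite ltW//; near: v; exact: lt_nbhsr.
  by rewrite min_l// ltW//; near: v; exact: lt_nbhsl.
rewrite (fundamental_past hX (_ : T - u < 0)) ?subr_lt0// !mul0mx.
apply: mxderiv_near (mxderiv_cst (Q T) u).
near=> v; rewrite min_r// le_max; apply/orP; left.
by rewrite ltW//; near: v; exact: lt_nbhsr.
Unshelve. all: by end_near. Qed.

(** The derivative of [u |-> X (T - u) * X u] telescopes to
    [\sum_j (h j u - h j (u + tau j))], where
    [h j u = X (T - u) * A j * X (u - tau j)]. Hence adding
    [\sum_j (H j (u + tau j) - H j u)], with [H j] a primitive of [h j], gives
    a function that is constant on [[0, t]]. *)
Lemma semigroup_defect s t : 0 < s -> 0 <= t ->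
  exists H : 'I_m -> R -> 'M[R]_n,
  [/\ forall j, mxcont (H j),
      forall j u, u != tau j -> u != t + s ->
        mxderiv (H j) u (X (t + s - u) *m A j *m X (u - tau j)) &
      X (t + s) = X s *m X t + \sum_j (H j (t + tau j) - H j t)].
Proof.
move=> s0 t0; set T := t + s.
have /choice[H HP] := fun j => convolution_primitive j T.
have cH j : mxcont (H j) by have [] := HP j.
have dH j u : u != tau j -> u != T ->
    mxderiv (H j) u (X (T - u) *m A j *m X (u - tau j)).
  by have [_ _] := HP j; exact.
exists H; split => //.
pose Psi u := Xplus (T - u) *m Xplus u + \sum_j (H j (u + tau j) - H j u).
suff : Psi t = Psi 0.
  rewrite /Psi [in RHS]big1 => [|j _].
    have Ts : T - t = s by rewrite /T; ring.
    have T0 : 0 <= T by rewrite addr_ge0// ltW.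
    rewrite !subr0 !Xplus_ge0 ?Ts ?(ltW s0)//.
    by rewrite (fundamental_init hX) mulmx1 addr0.
  by have [_ h _] := HP j; rewrite add0r h subrr.
(* The factor [X u] has kinks at the delays, [X (T - u)] at their mirror
   images. *)
apply: (mx_constant (S := delays ++ [seq T - tau j | j : 'I_m])) => //.
  apply: mxcontD.
    apply: mxcontM; last exact: Xplus_cont.
    by apply: (mxcont_comp (g := fun u => T - u)) Xplus_cont; exact: continuous_subl.
  apply: mxcont_sum => j; apply: mxcontB => //.
  apply: (mxcont_comp (g := fun u => u + tau j)) (cH j) => u.
  by apply: cvgD; [exact: cvg_id|exact: cvg_cst].
move=> u u0 ut; rewrite mem_cat negb_or => /andP[ud uTd].
have uT : u < T by rewrite /T; lra.
have Tud : T - u \notin delays.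
  apply: contra uTd => /mapP[j _ e]; apply/mapP; exists j; rewrite ?mem_enum//.
  by rewrite -e; ring.
have dXu := (Xplus_deriv u0 ud).1.
have dXTu : mxderiv Xplus (T - u) (right_op X (T - u)).
  by apply: (Xplus_deriv _ Tud).2; rewrite subr_gt0.
have dHs j : mxderiv (fun v => H j (v + tau j)) u
    (X (T - u - tau j) *m A j *m X u).
  apply: mxderiv_shift.
  have -> : X (T - u - tau j) *m A j *m X u =
      X (T - (u + tau j)) *m A j *m X (u + tau j - tau j).
    by rewrite addrK opprD addrA.
  apply: dH; first by apply: contraTneq u0 => e; rewrite -leNgt; lra.
  apply: contraNneq uTd => e; apply/mapP; exists j; rewrite ?mem_enum//.
  by rewrite -e; ring.
have dHu j := dH j u (notin_delays j ud) (negbT (lt_eqF uT)).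
have := mxderivD (mxderivM (mxderiv_reflect dXTu) dXu)
  (mxderiv_sum (fun j => mxderivB (dHs j) (dHu j))).
rewrite !Xplus_ge0 ?(ltW u0) ?subr_ge0 ?(ltW uT)//.
set D := (X in mxderiv _ _ X).
have -> : D = 0.
  rewrite /D /right_op /left_op mulNmx mulmxDl mulmxDr mulmx_suml mulmx_sumr sumrB.
  have -> : \sum_j X (T - u) *m (A j *m X (u - tau j)) =
     \sum_j X (T - u) *m A j *m X (u - tau j).
    by apply: eq_bigr => j _; rewrite mulmxA.
  rewrite mulmxA opprD addrACA.
  by rewrite subrK addrK addNr.
exact: mxderiv_right.
Qed.

(** In the integrals of the semigroup law, the argument of the left factor runs
    over [[s - tau j, s]] and that of the right factor over [[t - tau j, t]]. *)
Lemma nrm_semigroup_defect s t tmax a b : 0 < s -> 0 <= t ->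
  (forall j, tau j <= tmax) -> 0 <= tmax ->
  (forall v, s - tmax <= v -> v <= s -> nrm (X v) <= a) ->
  (forall v, t - tmax <= v -> v <= t -> nrm (X v) <= b) ->
  nrm (X (t + s)) <= (1 + n%:R ^+ 2 * \sum_j (nrm (A j) * tau j)) * (a * b).
Proof.
move=> s0 t0 tle tmax0 Xa Xb.
have [H [cH dH ->]] := semigroup_defect s0 t0.
have a0 : 0 <= a by apply: le_trans (nrm_ge0 (X s)) _; apply: Xa; lra.
have b0 : 0 <= b by apply: le_trans (nrm_ge0 (X t)) _; apply: Xb; lra.
apply: le_trans (nrmD _ _) _; rewrite mulrDl mul1r lerD//.
  apply: le_trans (nrmM _ _) _.
  by apply: ler_pM; rewrite ?nrm_ge0//; [apply: Xa|apply: Xb]; lra.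
apply: le_trans (nrm_sum _) _; rewrite -mulrA mulr_suml mulr_sumr.
apply: ler_sum => j _.
have -> : nrm (A j) * tau j * (a * b) = a * nrm (A j) * b * (t + tau j - t) by ring.
have tj := tau_gt0 j; have tj' := tle j.
apply: (mx_mean_value (S := [:: tau j; t + s])) => //; first by lra.
move=> u tu ut; rewrite !inE negb_or => /andP[uj us].
exists (X (t + s - u) *m A j *m X (u - tau j)).
  by apply: mxderiv_right; exact: dH.
apply: le_trans (nrmM _ _) _; apply: ler_pM; rewrite ?nrm_ge0//; last by apply: Xb; lra.
apply: le_trans (nrmM _ _) _; apply: ler_wpM2r; first exact: nrm_ge0.
by apply: Xa; lra.
Qed.

End FundamentalMatrix.
End DelaySystem.

(** * Sums of squares and comparison of matrix norms *)

Section SquareSum.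
Local Open Scope classical_set_scope.
Variables (R : realType) (n : nat).
Implicit Types (V W : 'M[R]_n) (K x : R).

Definition sqsum W : R := \sum_i \sum_j W i j ^+ 2.

Lemma sqsum_ge0 W : 0 <= sqsum W.
Proof. by apply: sumr_ge0 => i _; apply: sumr_ge0 => j _; exact: sqr_ge0. Qed.

Lemma sqsum0 : sqsum 0 = 0.
Proof. by apply: big1 => i _; apply: big1 => j _; rewrite mxE expr0n. Qed.

Lemma frobenius_sqr W : frobenius_norm W ^+ 2 = sqsum W.
Proof. by rewrite sqr_sqrtr// sqsum_ge0. Qed.

Lemma entry_sqsum W i j : W i j ^+ 2 <= sqsum W.
Proof.
rewrite /sqsum (bigD1 i)//= (bigD1 j)//= -addrA lerDl addr_ge0//.
  by apply: sumr_ge0 => k _; exact: sqr_ge0.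
by apply: sumr_ge0 => k _; apply: sumr_ge0 => l _; exact: sqr_ge0.
Qed.

Lemma nrm_sqsum W K : 0 <= K -> sqsum W <= K ^+ 2 -> nrm W <= n%:R ^+ 2 * K.
Proof.
move=> K0 WK; apply: (@le_trans _ _ (\sum_(i < n) \sum_(j < n) K)).
  apply: ler_sum => i _; apply: ler_sum => j _.
  rewrite -(ler_pXn2r (n := 2))// ?nnegrE// real_normK ?num_real//.
  exact: le_trans (entry_sqsum _ _ _) WK.
by rewrite sum_entries_const.
Qed.

Lemma sqsum_nrm W : sqsum W <= nrm W ^+ 2.
Proof.
rewrite expr2 {1}/nrm mulr_suml; apply: ler_sum => i _.
rewrite mulr_suml; apply: ler_sum => j _.
by rewrite -real_normK ?num_real// expr2 ler_wpM2l// entry_le_nrm.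
Qed.

(** Entry by entry, this is [2 * x * v * w <= `|v| * (x ^+ 2 + w ^+ 2)]. *)
Lemma entry_mulmx_le V W x i k :
  2 * x * (V *m W) i k <= nrm V * (x ^+ 2 + sqsum W).
Proof.
have G0 : 0 <= x ^+ 2 + sqsum W by rewrite addr_ge0 ?sqr_ge0 ?sqsum_ge0.
apply: (@le_trans _ _ (\sum_l `|V i l| * (x ^+ 2 + sqsum W))).
  rewrite mxE mulr_sumr; apply: ler_sum => l _.
  apply: (@le_trans _ _ (`|V i l| * (x ^+ 2 + W l k ^+ 2))); last first.
    by rewrite ler_wpM2l// lerD2l entry_sqsum.
  apply: le_trans (ler_norm _) _.
  rewrite mulrCA normrM ler_wpM2l// ler_norml; apply/andP; split.
    by have := sqr_ge0 (x + W l k); lra.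
  by have := sqr_ge0 (x - W l k); lra.
rewrite -mulr_suml ler_wpM2r//.
rewrite /nrm [leRHS](bigD1 i)//= lerDl; apply: sumr_ge0 => j _.
by apply: sumr_ge0 => l _.
Qed.

End SquareSum.

Section NormEquivalence.
Local Open Scope classical_set_scope.
Variables (R : realType) (n : nat) (N : 'M[R]_n -> R).
Hypothesis hN : is_matrix_norm N.
Implicit Types (V W : 'M[R]_n).

Lemma matrix_norm0 : N 0 = 0.
Proof. by rewrite -(scale0r 0) (matrix_normZ hN) normr0 mul0r. Qed.

Lemma matrix_normN W : N (- W) = N W.
Proof. by rewrite -scaleN1r (matrix_normZ hN) normrN1 mul1r. Qed.

Lemma matrix_norm_ge0 W : 0 <= N W.
Proof.
have := matrix_norm_triangle hN W (- W).
by rewrite subrr matrix_norm0 matrix_normN; lra.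
Qed.

Lemma matrix_norm_sum (I : finType) (f : I -> 'M[R]_n) :
  N (\sum_i f i) <= \sum_i N (f i).
Proof.
elim/big_ind2 : _ => [|x V y W xV yW|//]; first by rewrite matrix_norm0.
exact: le_trans (matrix_norm_triangle hN _ _) (lerD xV yW).
Qed.

Lemma matrix_norm_le_nrm : exists2 c, 0 < c & forall W, N W <= c * nrm W.
Proof.
pose c := \sum_i \sum_j N (delta_mx i j).
have c0 : 0 <= c.
  by apply: sumr_ge0 => i _; apply: sumr_ge0 => j _; exact: matrix_norm_ge0.
exists (c + 1) => [|W]; first by lra.
rewrite [W in N W]matrix_sum_delta; apply: le_trans (matrix_norm_sum _) _.
rewrite /nrm mulr_sumr; apply: ler_sum => i _.
apply: le_trans (matrix_norm_sum _) _; rewrite mulr_sumr; apply: ler_sum => j _.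
rewrite (matrix_normZ hN) mulrC ler_wpM2r//.
apply: (@le_trans _ _ c); last by lra.
rewrite /c (bigD1 i)//= (bigD1 j)//= -addrA lerDl addr_ge0//.
  by apply: sumr_ge0 => k _; exact: matrix_norm_ge0.
by apply: sumr_ge0 => k _; apply: sumr_ge0 => l _; exact: matrix_norm_ge0.
Qed.

(** A norm is continuous for the sup norm and attains a positive minimum on
    the compact unit sphere, taken here in the space of row vectors that list
    the entries. *)
Lemma nrm_le_matrix_norm : exists2 c, 0 < c & forall W, nrm W <= c * N W.
Proof.
have [[W0 W0n0]|nW] := pselect (exists W : 'M[R]_n, W != 0); last first.
  exists 1 => // W; have -> : W = 0.
    by apply/eqP; apply: contra_notT nW => ?; exists W.
  by rewrite nrm0 matrix_norm0 mulr0.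
have [c c0 Nc] := matrix_norm_le_nrm.
have entry_le (v : 'rV[R]_(n * n)) i j : `|vec_mx v i j| <= `|v|.
  rewrite mxE [leRHS]/Num.Def.normr/= mx_normrE.
  exact: (le_bigmax _ (fun ij => `|v ij.1 ij.2|) (ord0, mxvec_index i j)).
have nrm_le (v : 'rV[R]_(n * n)) : nrm (vec_mx v) <= n%:R ^+ 2 * `|v|.
  apply: (@le_trans _ _ (\sum_(i < n) \sum_(j < n) `|v|)).
    by apply: ler_sum => i _; apply: ler_sum => j _.
  by rewrite sum_entries_const.
pose f (v : 'rV[R]_(n * n)) := N (vec_mx v).
have cf : continuous f.
  move=> v; apply/(@cvgrPdist_le _ _ _ (nbhs v) (nbhs_filter v)) => e e0.
  have k0 : 0 <= c * n%:R ^+ 2 by rewrite mulr_ge0 ?exprn_ge0// ltW.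
  pose d := e / (c * n%:R ^+ 2 + 1).
  have d0 : 0 < d by rewrite divr_gt0//; lra.
  have nd : \forall w \near v, `|v - w| <= d.
    by apply/nbhs_ballP; exists d => //= w; rewrite -ball_normE /= => /ltW.
  apply: filterS nd => w vw.
  have Nvw (x y : 'rV[R]_(n * n)) : f x - f y <= f (x - y).
    rewrite lerBlDr /f -[X in N (vec_mx X) <= _](subrK y) linearD.
    exact: matrix_norm_triangle.
  have : f (v - w) <= e.
    apply: le_trans (Nc _) _; apply: (@le_trans _ _ (c * (n%:R ^+ 2 * d))).
      rewrite ler_pM2l//; apply: le_trans (nrm_le _) _.
      by rewrite ler_wpM2l// exprn_ge0.
    rewrite mulrA /d mulrCA ler_piMr ?(ltW e0)// ler_pdivrMr; lra.
  have fC : f (w - v) = f (v - w) by rewrite /f -opprB linearN matrix_normN.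
  by have := Nvw v w; have := Nvw w v; rewrite fC ler_norml; lra.
pose S := [set v : 'rV[R]_(n * n) | `|v| = 1].
have cS : compact S.
  apply: bounded_closed_compact.
    by exists 1; split; rewrite ?num_real// => x x1 v /= ->; exact: ltW.
  have -> : S = (fun v : 'rV[R]_(n * n) => `|v|) @^-1` [set 1] by [].
  apply: preimage_closed => [v _|]; last exact: closed_eq.
  exact: norm_continuous.
have S0 : S !=set0.
  have v0 : mxvec W0 != 0 by rewrite mxvec_eq0.
  exists (`|mxvec W0|^-1 *: mxvec W0).
  by rewrite /S /= normrZ normfV normr_id mulVf// normr_eq0.
have [v vS vmin] := EVT_min_rV S0 cS (continuous_subspaceT cf).
rewrite inE /S /= in vS.
have mu0 : 0 < f v.
  rewrite lt_neqAle matrix_norm_ge0 andbT eq_sym; apply/eqP => fv0.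
  have := matrix_norm_eq0 hN fv0 => /(congr1 mxvec); rewrite vec_mxK linear0 => v0.
  by move: vS; rewrite v0 normr0 => /eqP; rewrite eq_sym oner_eq0.
exists ((n%:R ^+ 2 + 1) / f v) => [|W].
  by rewrite divr_gt0// ltr_wpDl// exprn_ge0.
have [->|W0'] := eqVneq W 0; first by rewrite nrm0 matrix_norm0 mulr0.
have w0 : 0 < `|mxvec W| by rewrite normr_gt0 mxvec_eq0.
have : f v <= f (`|mxvec W|^-1 *: mxvec W).
  apply: vmin; rewrite inE /S /= normrZ normfV normr_id mulVf//.
  by rewrite gt_eqF.
rewrite /f linearZ /= mxvecK (matrix_normZ hN) gtr0_norm ?invr_gt0//.
rewrite -/(f v) ler_pdivlMl// => h.
rewrite -[W in nrm W]mxvecK; apply: le_trans (nrm_le _) _.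
rewrite [leRHS]mulrAC ler_pdivlMr//.
have n2 : 0 <= n%:R ^+ 2 :> R by exact: exprn_ge0.
rewrite -mulrA; apply: ler_pM => //; last by lra.
by rewrite mulr_ge0// ltW.
Qed.

End NormEquivalence.

(** * Square integrability and exponential decay *)

Section ExponentialDecay.
Local Open Scope classical_set_scope.
Variables (R : realType) (n m : nat) (A0 : 'M[R]_n) (A : 'I_m -> 'M[R]_n).
Variables (tau : 'I_m -> R).
Hypothesis tau_gt0 : forall j, 0 < tau j.
Variable X : R -> 'M[R]_n.
Hypothesis hX : is_fundamental_matrix A0 A tau X.
Implicit Types (s t u : R).

Lemma tau_le_sum j : tau j <= \sum_i tau i.
Proof.
by rewrite (bigD1 j)//= lerDl; apply: sumr_ge0 => i _; exact: ltW.
Qed.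

Lemma energy_primitive : exists F : R -> R,
  [/\ continuous F, forall t, t <= 0 -> F t = 0,
      forall t, t != 0 -> is_derive t 1 F (sqsum (X t)) &
      forall t, 0 <= t ->
        (\int[lebesgue_measure]_(s in `[0%R, t])
          (frobenius_norm (X s) ^+ 2)%:E)%E = (F t)%:E].
Proof.
have cX : continuous (fun t => sqsum (Xplus X t)).
  apply: continuous_bigsum => i; apply: continuous_bigsum => j t.
  by apply: cvgM; exact: (Xplus_cont hX).
have [F [cF F0 dF iF]] := causal_primitive cX.
exists F; split => //.
  move=> t; rewrite neq_lt => /orP[t0|t0]; last first.
    by rewrite -(@Xplus_ge0 _ _ X)// ?(ltW t0)//; exact: dF.
  rewrite (fundamental_past hX t0) sqsum0.
  apply: near_eq_is_derive (is_derive_cst 0 t 1).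
  by near=> u; rewrite F0// ltW//; near: u; exact: lt_nbhsl.
move=> t t0; rewrite -iF//; apply: eq_integral => s.
by rewrite inE /= in_itv /= => /andP[s0 _]; rewrite frobenius_sqr Xplus_ge0.
Unshelve. all: by end_near. Qed.

Lemma nondecreasing_of_deriv (F : R -> R) : continuous F ->
  (forall t, t != 0 -> is_derive t 1 F (sqsum (X t))) ->
  {homo F : s t / s <= t}.
Proof.
move=> cF dF s t st; rewrite -lerN2.
apply: (@right_deriv_le0 _ (fun u => - F u) [:: 0]) => //.
  by move=> u; apply: cvgN; exact: cF.
move=> u _ _; rewrite inE => u0; exists (- sqsum (X u)).
  by apply: is_derive_right; exact: is_deriveN (dF u u0).
by rewrite oppr_le0 sqsum_ge0.
Qed.

(** Up to the factor [energy_coef], a primitive of the bound on the derivative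
    of [sqsum X]. *)
Definition energy_window (F : R -> R) t := 2 * F t + \sum_j F (t - tau j).

Definition energy_coef : R := n%:R ^+ 2 * coef_norm A0 A.

(** The derivative of [sqsum X] is a sum of products [2 * x * a * y] of an
    entry [x] at time [t], a coefficient [a] and an entry [y] at time [t] or
    [t - tau j]; each is at most [`|a| * (x ^+ 2 + y ^+ 2)]. So
    [sqsum X - energy_coef * energy_window F] is nonincreasing. *)
Lemma sqsum_growth (F : R -> R) : continuous F ->
  (forall t, t != 0 -> is_derive t 1 F (sqsum (X t))) ->
  forall a b, 0 <= a -> a <= b ->
  sqsum (X b) <= sqsum (X a) +
    energy_coef * (energy_window F b - energy_window F a).
Proof.
move=> cF dF a b a0 ab.
have cshift j : continuous (fun u => F (u - tau j)).
  move=> u; apply: (@continuous_comp _ _ _ (fun u => u - tau j) F).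
    exact: continuous_subr.
  exact: cF.
pose V t := sqsum (Xplus X t) - energy_coef * energy_window F t.
suff : V b <= V a.
  rewrite /V !Xplus_ge0//; first by lra.
  exact: le_trans ab.
apply: (right_deriv_le0 (S := delays tau)) => //.
  move=> t; apply: cvgB.
    apply: continuous_bigsum => i; apply: continuous_bigsum => j u.
    by apply: cvgM; exact: (Xplus_cont hX).
  apply: cvgMl_tmp; apply: cvgD; first by apply: cvgMl_tmp; exact: cF.
  by apply: continuous_bigsum => j; exact: cshift.
move=> t at_ _ td; have t0 : 0 < t by exact: le_lt_trans at_.
have dX := (Xplus_deriv tau_gt0 hX t0 td).1.
have dsq : is_derive t 1 (fun u => sqsum (Xplus X u))
    (\sum_i \sum_j 2 * X t i j * left_op A0 A tau X t i j).
  apply: is_derive_bigsum => i; apply: is_derive_bigsum => j.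
  apply: (is_derive_eq (is_deriveX 2 (dX i j))).
  by rewrite Xplus_ge0 ?(ltW t0)// expr1 /GRing.scale.
have dW : is_derive t 1 (energy_window F)
    (2 * sqsum (X t) + \sum_j sqsum (X (t - tau j))).
  have d1 : is_derive t 1 (fun u => 2 * F u) (2 * sqsum (X t)).
    by apply: (is_deriveZ 2 (dF t _)); rewrite gt_eqF.
  apply: (is_deriveD d1); apply: is_derive_bigsum => j.
  rewrite -[sqsum _]mulr1.
  apply: (@is_derive1_comp _ F (fun u => u - tau j) _ _ _ _
    (is_derive_shift t 1 (- tau j))).
  by apply: dF; rewrite subr_eq0 notin_delays.
eexists.
  exact: (is_derive_right (is_deriveB dsq (is_deriveZ energy_coef dW))).
rewrite subr_le0 /GRing.scale /=.
set G := 2 * _ + _.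
apply: (@le_trans _ _ (\sum_(i < n) \sum_(j < n) coef_norm A0 A * G)); last first.
  by rewrite sum_entries_const /energy_coef mulrA.
apply: ler_sum => i _; apply: ler_sum => k _.
rewrite /left_op mxE mulrDr /coef_norm [leRHS]mulrDl; apply: lerD.
  apply: le_trans (entry_mulmx_le _ _ _ _ _) _; rewrite ler_wpM2l ?nrm_ge0//.
  have := entry_sqsum (X t) i k.
  have : 0 <= \sum_j sqsum (X (t - tau j)).
    by apply: sumr_ge0 => j _; exact: sqsum_ge0.
  by rewrite /G; lra.
rewrite summxE mulr_sumr mulr_suml; apply: ler_sum => j _.
apply: le_trans (entry_mulmx_le _ _ _ _ _) _; rewrite ler_wpM2l ?nrm_ge0//.
have := entry_sqsum (X t) i k; have := sqsum_ge0 (X t).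
have : sqsum (X (t - tau j)) <= \sum_j sqsum (X (t - tau j)).
  by rewrite [leRHS](bigD1 j)//= lerDl; apply: sumr_ge0 => l _; exact: sqsum_ge0.
by rewrite /G; lra.
Qed.

(** Growth beyond a late time [a] is small, since it is bounded by a late
    increment of the energy [F]; and [sqsum X] cannot remain above [q / 2]
    after time [S1], for then [F] would grow linearly. *)
Lemma square_integrable_decay :
  improper_integral_finite (fun s => frobenius_norm (X s) ^+ 2) ->
  (exists2 B, 0 <= B & forall t, nrm (X t) <= B) /\
  (forall d, 0 < d -> exists T, forall t, T <= t -> nrm (X t) <= d).
Proof.
move=> [l hl].
have [F [cF F0 dF iF]] := energy_primitive.
have mF := nondecreasing_of_deriv cF dF.
have Fl : F t @[t --> +oo] --> l.
  suff : (F t)%:E @[t --> +oo] --> l%:E by move=> /fine_cvgP[].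
  apply: cvg_trans hl; apply: near_eq_cvg; near=> t.
  by rewrite iF//; near: t; apply: nbhs_pinfty_ge; rewrite num_real.
have Fle t : F t <= l.
  rewrite leNgt; apply/negP => lt.
  have : \forall u \near +oo, F u < F t by exact: (cvgr_lt l Fl).
  move=> h; near (pinfty_nbhs R) => u.
  have : F t <= F u.
    by apply: mF; near: u; apply: nbhs_pinfty_ge; rewrite num_real.
  by rewrite leNgt; apply/negP; rewrite negbK; near: u.
have F_ge0 t : 0 <= F t.
  by have [/F0->//|/ltW t0] := leP t 0; rewrite -(F0 0)// mF.
have l0 : 0 <= l := le_trans (F_ge0 0) (Fle 0).
have C0 : 0 <= energy_coef.
  by rewrite mulr_ge0 ?exprn_ge0 ?coef_norm_ge0.
have window a b d : (forall t, a - \sum_i tau i <= t -> l - d <= F t) ->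
    energy_window F b - energy_window F a <= (2 + m%:R) * d.
  have tau0 : 0 <= \sum_i tau i by apply: sumr_ge0 => i _; exact: ltW.
  move=> hd; rewrite /energy_window opprD addrACA -mulrBr -sumrB.
  rewrite [leRHS]mulrDl; apply: lerD.
    have : l - d <= F a by apply: hd; lra.
    by have := Fle b; lra.
  rewrite -[m in m%:R]card_ord -sum1_card natr_sum mulr_suml.
  apply: ler_sum => j _; have : l - d <= F (a - tau j).
    by apply: hd; have := tau_le_sum j; lra.
  by have := Fle (b - tau j); lra.
split.
  pose K := sqsum (X 0) + energy_coef * ((2 + m%:R) * l).
  have K0 : 0 <= K.
    by rewrite addr_ge0 ?sqsum_ge0// mulr_ge0// mulr_ge0// addr_ge0.
  exists (n%:R ^+ 2 * (K + 1)) => [|t].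
    by rewrite mulr_ge0 ?exprn_ge0// addr_ge0.
  apply: nrm_sqsum; first by rewrite addr_ge0.
  have [t0|t0] := ltP t 0.
    by rewrite (fundamental_past hX t0) sqsum0 sqr_ge0.
  apply: le_trans (sqsum_growth cF dF (lexx 0) t0) _.
  apply: (@le_trans _ _ K); last by nra.
  rewrite lerD2l ler_wpM2l// window// => u _.
  by rewrite subrr.
move=> d d0.
pose q := (d / (n%:R ^+ 2 + 1)) ^+ 2.
have q0 : 0 < q by rewrite exprn_gt0// divr_gt0// ltr_wpDl// exprn_ge0.
pose e := q / 2 / (energy_coef * (2 + m%:R) + 1).
have e0 : 0 < e.
  by rewrite !divr_gt0// ltr_wpDl// mulr_ge0// addr_ge0.
have [S hS] : exists S, forall t, S <= t -> l - e <= F t.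
  have /cvgrPdist_le/(_ e e0)[S [_ hS]] := Fl.
  exists (S + 1) => t St; have : S < t by lra.
  by move=> /hS; rewrite ler_norml => /andP[_]; lra.
pose S1 := Num.max S 0 + \sum_i tau i.
have S10 : 0 <= S1.
  by rewrite addr_ge0 ?le_max ?lexx ?orbT// sumr_ge0// => i _; exact: ltW.
have [a Sa Xa] : exists2 a, S1 <= a & sqsum (X a) <= q / 2.
  apply: contrapT => none.
  have big u : S1 <= u -> q / 2 <= sqsum (X u).
    by move=> u1; rewrite leNgt; apply/negP => /ltW h; apply: none; exists u.
  (* On [[S1, b]] the energy would grow by [l + 1], more than its total [l]. *)
  pose b : R := S1 + (l + 1) / (q / 2).
  have q2 : 0 < q / 2 by rewrite divr_gt0.
  have Sb : S1 <= b by rewrite lerDl divr_ge0//; lra.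
  have : q / 2 * b - F b <= q / 2 * S1 - F S1.
    apply: (@right_deriv_le0 _ (fun u => q / 2 * u - F u) [::]) => //.
      by move=> u; apply: cvgB; [exact: continuous_mull|exact: cF].
    move=> u Su _ _; exists (q / 2 - sqsum (X u)); last first.
      by rewrite subr_le0; apply: big; exact: ltW.
    apply: is_derive_right.
    rewrite -[X in X - _]mulr1.
    apply: (is_deriveB (is_deriveZ (q / 2) (is_derive_id u 1)) (dF u _)).
    by rewrite gt_eqF// (le_lt_trans S10).
  have -> : q / 2 * b = q / 2 * S1 + (l + 1).
    by rewrite /b mulrDr [X in _ + X]mulrC divfK// gt_eqF.
  by have := Fle b; have := F_ge0 S1; lra.
exists a => t at_.
have -> : d = (n%:R ^+ 2 + 1) * (d / (n%:R ^+ 2 + 1)).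
  by rewrite mulrC divfK// gt_eqF// ltr_wpDl// exprn_ge0.
have dq0 : 0 <= d / (n%:R ^+ 2 + 1).
  by rewrite divr_ge0 ?(ltW d0)// addr_ge0// exprn_ge0.
apply: (@le_trans _ _ (n%:R ^+ 2 * (d / (n%:R ^+ 2 + 1)))); last first.
  by rewrite ler_wpM2r// lerDl.
apply: nrm_sqsum => //; rewrite -/q.
apply: le_trans (sqsum_growth cF dF (le_trans S10 Sa) at_) _.
have wa : energy_window F t - energy_window F a <= (2 + m%:R) * e.
  apply: window => u au; apply: hS; move: Sa; rewrite /S1 => Sa.
  have : S <= Num.max S 0 by rewrite le_max lexx.
  by lra.
have : energy_coef * ((2 + m%:R) * e) <= q / 2.
  have -> : energy_coef * ((2 + m%:R) * e) = q / 2 *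
      (energy_coef * (2 + m%:R) / (energy_coef * (2 + m%:R) + 1)).
    by rewrite /e; ring.
  rewrite ler_piMr ?divr_ge0 ?(ltW q0)//.
  have c0 : 0 <= energy_coef * (2 + m%:R) by rewrite mulr_ge0// addr_ge0.
  by rewrite ler_pdivrMr ?mul1r; lra.
have := ler_wpM2l C0 wa; lra.
Unshelve. all: by end_near. Qed.

(** Halving on each interval of length [L] is decay at rate [ln 2 / L]; the
    factor 2 in the constant pays for the incomplete last interval. *)
Lemma exponential_of_halving (f : R -> R) (B L : R) : 0 <= B -> 0 < L ->
  (forall (k : nat) t, k%:R * L <= t -> f t <= B / 2 ^+ k) ->
  exists alpha gamma, [/\ 0 < alpha, 0 < gamma &
    forall t, 0 <= t -> f t <= gamma * expR (- alpha * t)].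
Proof.
move=> B0 L0 fB.
have ln2 : 0 < ln 2 :> R by rewrite ln_gt0// ltr1n.
exists (ln 2 / L), (2 * B + 1); split; [exact: divr_gt0|lra|].
move=> t t0; pose k := Num.truncn (t / L).
have /andP[kt tk] : k%:R <= t / L < k.+1%:R.
  by apply: truncn_itv; rewrite divr_ge0// ltW.
apply: le_trans (fB k t _) _; first by rewrite -ler_pdivlMr.
have h : expR (ln 2 / L * t) <= 2 * 2 ^+ k.
  rewrite -exprS -[X in X ^+ _](@lnK _ 2) ?posrE// -expRM_natr ler_expR.
  by rewrite mulrAC -mulrA ler_wpM2l ?(ltW ln2)// ltW.
rewrite mulNr expRN.
have e0 : 0 < expR (ln 2 / L * t) := expR_gt0 _.
have p0 : 0 < 2 ^+ k :> R by rewrite exprn_gt0.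
rewrite ler_pdivrMr// mulrAC ler_pdivlMr//.
apply: (@le_trans _ _ (B * (2 * 2 ^+ k))); first by rewrite ler_wpM2l.
by rewrite mulrA [B * 2]mulrC ler_wpM2r ?(ltW p0)//; lra.
Qed.

(** For [s] so late that [X] is at most [(2 * c)^-1] on the window ending at
    [s], the approximate semigroup law turns a bound on the window ending at
    [r - s] into half of it at [r]. The window starts [s + tmax] before [r],
    whence the period of the halving. *)
Lemma square_integrable_exponential :
  improper_integral_finite (fun s => frobenius_norm (X s) ^+ 2) ->
  exists alpha gamma, [/\ 0 < alpha, 0 < gamma &
    forall t, 0 <= t -> nrm (X t) <= gamma * expR (- alpha * t)].
Proof.
move=> /square_integrable_decay[[B B0 XB] Xd].
pose c := 1 + n%:R ^+ 2 * \sum_j (nrm (A j) * tau j).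
have c0 : 0 < c.
  rewrite ltr_pwDl// mulr_ge0 ?exprn_ge0// sumr_ge0// => j _.
  by rewrite mulr_ge0 ?nrm_ge0// ltW.
have d0 : 0 < (2 * c)^-1 by rewrite invr_gt0 mulr_gt0.
have [T hT] := Xd _ d0.
pose tmax := \sum_j tau j.
have tmax0 : 0 <= tmax by apply: sumr_ge0 => j _; exact: ltW.
pose s := Num.max T 0 + tmax + 1.
have Ts : T <= s - tmax.
  by have : T <= Num.max T 0; [rewrite le_max lexx|rewrite /s; lra].
have s0 : 0 < s.
  by rewrite ltr_wpDl// addr_ge0// le_max lexx orbT.
apply: (@exponential_of_halving _ B (s + tmax) B0); first by lra.
elim=> [|k IH] r kr; first by rewrite expr0 divr1.
have k0 : 0 <= k%:R * (s + tmax) by rewrite mulr_ge0//; lra.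
have kS : k.+1%:R * (s + tmax) = k%:R * (s + tmax) + (s + tmax).
  by rewrite -addn1 natrD mulrDl mul1r.
have -> : r = (r - s) + s by rewrite subrK.
have rs0 : 0 <= r - s by lra.
apply: le_trans (nrm_semigroup_defect (a := (2 * c)^-1) (b := B / 2 ^+ k)
  tau_gt0 hX s0 rs0 tau_le_sum tmax0 _ _) _.
- by move=> v; rewrite -/tmax => vs _; apply: hT; exact: le_trans vs.
- by move=> v; rewrite -/tmax => vs _; apply: IH; lra.
have -> : B / 2 ^+ k.+1 = c * ((2 * c)^-1 * (B / 2 ^+ k)).
  by rewrite exprS; field; rewrite expf_neq0 ?gt_eqF.
by [].
Qed.

(** The energy [F] is nondecreasing, so it converges once it is bounded; and
    [F + K * expR (- 2 * alpha * t)] is nonincreasing for the constant [K]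
    that makes the derivative of the second term cancel the bound
    [c ^+ 2 * expR (- 2 * alpha * t)] on [sqsum (X t)]. *)
Lemma exponential_square_integrable (c alpha : R) : 0 < alpha ->
  (forall t, 0 <= t -> nrm (X t) <= c * expR (- alpha * t)) ->
  improper_integral_finite (fun s => frobenius_norm (X s) ^+ 2).
Proof.
move=> alpha0 Xe.
have [F [cF F0 dF iF]] := energy_primitive.
have mF := nondecreasing_of_deriv cF dF.
pose K := c ^+ 2 / (2 * alpha).
have a2 : 0 < 2 * alpha by rewrite mulr_gt0.
have K0 : 0 <= K by rewrite divr_ge0 ?sqr_ge0 ?ltW.
pose g t := K * expR (- (2 * alpha) * t).
have dg t : is_derive t 1 g (- (c ^+ 2 * expR (- (2 * alpha) * t))).
  have dl : is_derive t 1 (fun u : R => - (2 * alpha) * u) (- (2 * alpha)).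
    apply: (is_derive_eq (is_deriveZ (- (2 * alpha)) (is_derive_id t 1))).
    exact: mulr1.
  have de := @is_derive1_comp _ expR (fun u => - (2 * alpha) * u) _ _ _
    (is_derive_expR _) dl.
  apply: (is_derive_eq (is_deriveZ K de)).
  rewrite /GRing.scale /= /K; field.
  by rewrite gt_eqF.
have cg : continuous g.
  move=> t; apply: differentiable_continuous; apply/derivable1_diffP.
  by have [] := dg t.
have bF t : F t <= K.
  have [/F0->//|/ltW t0] := leP t 0.
  have : F t + g t <= F 0 + g 0.
    apply: (@right_deriv_le0 _ (fun u => F u + g u) [::]) => //.
      by move=> u; apply: cvgD; [exact: cF|exact: cg].
    move=> u u0 _ _; exists (sqsum (X u) + - (c ^+ 2 * expR (- (2 * alpha) * u))).
      apply: is_derive_right; apply: (is_deriveD (dF u _) (dg u)).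
      by rewrite gt_eqF.
    rewrite subr_le0; apply: le_trans (sqsum_nrm _) _.
    have -> : - (2 * alpha) * u = 2 * (- alpha * u) by ring.
    have Xu := Xe u (ltW u0).
    by rewrite expRM_natl -exprMn ler_pXn2r ?nnegrE ?nrm_ge0// (le_trans _ Xu) ?nrm_ge0.
  rewrite (F0 0)// /g mulr0 expR0 mulr1.
  have : 0 <= K * expR (- (2 * alpha) * t) by rewrite mulr_ge0 ?expR_ge0.
  lra.
exists (sup (range F)).
have ubF : has_ubound (range F) by exists K => _ [t _ <-].
have cvF := nondecreasing_cvgr mF ubF.
have : (F t)%:E @[t --> +oo] --> (sup (range F))%:E.
  by apply/fine_cvgP; split; [exact: nearW|].
apply: cvg_trans; apply: near_eq_cvg; near=> t.
by rewrite iF//; near: t; apply: nbhs_pinfty_ge; rewrite num_real.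
Unshelve. all: by end_near. Qed.

Lemma fundamental_unique Y : is_fundamental_matrix A0 A tau Y -> Y = X.
Proof.
move=> hY; apply/funext => t; apply/subr0_eq.
have DE : (fun u => Y u - X u) = (fun u => Xplus Y u - Xplus X u).
  apply/funext => u; have [u0|u0] := leP 0 u; first by rewrite !Xplus_ge0.
  rewrite /Xplus max_r ?(ltW u0)// (fundamental_init hX) (fundamental_init hY).
  by rewrite (fundamental_past hX u0) (fundamental_past hY u0) !subrr.
apply: (delay_unique (S := [::]) tau_gt0 (E := fun u => Y u - X u)) => //.
- rewrite DE; apply: mxcontB; [exact: Xplus_cont hY|exact: Xplus_cont hX].
- move=> u; rewrite le_eqVlt => /predU1P[->|u0].
    by rewrite (fundamental_init hX) (fundamental_init hY) subrr.
  by rewrite (fundamental_past hX u0) (fundamental_past hY u0) subrr.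
- move=> u u0 _; rewrite left_opB DE.
  apply: mxrderivB; first by apply: Xplus_right_deriv hY _ _; exact: ltW.
  by apply: Xplus_right_deriv hX _ _; exact: ltW.
Qed.

End ExponentialDecay.

Theorem theorem3p3 (R : realType) (n m : nat) (hn : (1 <= n)%N)
    (hm : (1 <= m)%N) (A0 : 'M[R]_n) (A : 'I_m -> 'M[R]_n)
    (tau : 'I_m -> R) (htau : forall j, 0 < tau j)
    (X : R -> 'M[R]_n) (hX : is_fundamental_matrix A0 A tau X)
    (N : 'M[R]_n -> R) (hN : is_matrix_norm N) :
  asymptotically_stable N A0 A tau <->
  improper_integral_finite (fun s => frobenius_norm (X s) ^+ 2).
Proof.
split.
- move=> [Y hY [alpha [gamma [alpha0 _ Ye]]]].
  rewrite (fundamental_unique htau hX hY) in Ye.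
  have [c c0 Nc] := nrm_le_matrix_norm hN.
  apply: (exponential_square_integrable hX (c := c * gamma) alpha0) => t t0.
  apply: le_trans (Nc _) _; rewrite -mulrA ler_pM2l//.
  exact: Ye.
- move=> /(square_integrable_exponential htau hX)[alpha [gamma [alpha0 gamma0 Xe]]].
  have [c c0 Nc] := matrix_norm_le_nrm hN.
  exists X => //; exists alpha, (c * gamma); split => //; first exact: mulr_gt0.
  move=> t t0; apply: le_trans (Nc _) _; rewrite -mulrA ler_pM2l//.
  exact: Xe.
Qed.
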